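(* Let $\gamma,\kappa>0$, let $A:\mathbb{R}^n\to\mathbb{R}$ be a $\gamma$-function and $V:\mathbb{R}^n\to\mathbb{R}$ a $\kappa$-function, and let $q>0$ be such that $q+V(x)+A(\xi)\ge 1$ for all $x,\xi\in\mathbb{R}^n$. Then the metric $g=g^{(A,V)}$ on $\mathbb{R}^n\times\mathbb{R}^n$ given by $$g^{(A,V)}=\frac{dx^2}{(q+V(x)+A(\xi))^{\frac1\kappa}}+\frac{d\xi^2}{(q+V(x)+A(\xi))^{\frac1\gamma}}$$ is a Hörmander metric.
   Context: $\tau$-functions: a continuous function $\Gamma:\mathbb{R}^n\to\mathbb{R}$ is a $\tau$-function ($\tau>0$) if there is $q_0>0$ such that (a) $\Gamma(x)+\frac{q_0}{4}>0$ for all $x\in\mathbb{R}^n$; and (b) there are $C_1>0$, $R>0$ with $C_1\big|(\frac{q_0}{2}+\Gamma(x))^{\frac1{2\tau}}-(\frac{q_0}{2}+\Gamma(y))^{\frac1{2\tau}}\big|\le |x-y|$ for all $|x|,|y|\ge R$. The notation for the metric means: for $X=(x,\xi)$ and $T=(t,\tau)$ in $\mathbb{R}^n\times\mathbb{R}^n$, $g_X(T)=\frac{|t|^2}{(q+V(x)+A(\xi))^{1/\kappa}}+\frac{|\tau|^2}{(q+V(x)+A(\xi))^{1/\gamma}}$. Hörmander metric: a family $g_X(\cdot)$, $X\in\mathbb{R}^n\times\mathbb{R}^n$, of positive definite quadratic forms on $\mathbb{R}^n\times\mathbb{R}^n$ is a Hörmander metric if: (1) (continuity/slowness) there is $C>0$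 such that $g_X(X-Y)\le C^{-1}$ implies $\left(\frac{g_X(T)}{g_Y(T)}\right)^{\pm1}\le C$ for all $T\neq0$; (2) (uncertainty principle) $\lambda_g(X):=\inf_{T\ne0}\left(\frac{g_X^\sigma(T)}{g_X(T)}\right)^{1/2}\ge1$ for all $X$, where $g_X^\sigma(T):=\sup_{Y\neq0}\frac{\sigma(Y,T)^2}{g_X(Y)}$ and $\sigma(Y,T)=t\cdot\eta-y\cdot\tau$ for $Y=(y,\eta)$, $T=(t,\tau)$; (3) (temperateness) there are $\overline C>0$ and $J\in\mathbb{N}$ such that $\left(\frac{g_X(T)}{g_Y(T)}\right)^{\pm1}\le\overline C\,(1+g_Y^\sigma(X-Y))^J$ for all $X,Y$ and all $T\ne0$. *)

(* Defs.v *)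
From HB Require Import structures.
From mathcomp Require Import all_boot all_order all_algebra.
From mathcomp Require Import all_classical all_reals all_analysis.
Set Implicit Arguments.
Unset Strict Implicit.
Unset Printing Implicit Defensive.
Import Order.TTheory GRing.Theory Num.Theory.
Import numFieldNormedType.Exports.
Local Open Scope classical_set_scope.
Local Open Scope ring_scope.

Definition dotv (R : realType) (n : nat) (u v : 'rV[R]_n) : R :=
  \sum_(i < n) u 0 i * v 0 i.

(* The norm `|u| that the library puts on row vectors is the sup norm, hence a
   separate Euclidean norm. The library topology on 'rV[R]_n (entrywise
   convergence) is the usual one, so [continuous] can be used as it is. *)
Definition enorm (R : realType) (n : nat) (u : 'rV[R]_n) : R :=
  Num.sqrt (dotv u u).

(* In both uses of powR below the base is positive: by the second clause here,
   and by the normalisation 1 <= q + V x + A xi for [metricAV]. *)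
Definition tau_function (R : realType) (n : nat) (tau : R)
    (Gamma : 'rV[R]_n -> R) : Prop :=
  continuous Gamma /\
  exists q0 : R,
    [/\ 0 < q0,
        forall x, 0 < Gamma x + q0 / 4 &
        exists C1 r : R,
          [/\ 0 < C1, 0 < r &
              forall x y, r <= enorm x -> r <= enorm y ->
                C1 * `| (q0 / 2 + Gamma x) `^ (1 / (2 * tau))
                        - (q0 / 2 + Gamma y) `^ (1 / (2 * tau)) |
                <= enorm (x - y)]].

Definition phase (R : realType) (n : nat) : lmodType R :=
  ('rV[R]_n * 'rV[R]_n)%type.

Definition symp (R : realType) (n : nat) (Y T : phase R n) : R :=
  dotv T.1 Y.2 - dotv Y.1 T.2.

(* {dot _ for idfun} is the library type of positive definite symmetric
   bilinear forms. *)
Definition posdef_quadratic (R : realType) (n : nat) (Q : phase R n -> R)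
    : Prop :=
  exists B : {dot (phase R n) for (idfun : R -> R)}, forall T, Q T = B T T.

(* The suprema and infima are taken in the extended reals, so that no
   finiteness is presupposed. *)
Definition g_sigma (R : realType) (n : nat) (g : phase R n -> phase R n -> R)
    (X T : phase R n) : \bar R :=
  ereal_sup [set (symp Y T ^+ 2 / g X Y)%:E | Y in [set Y | Y != 0]].

Definition lambda_g (R : realType) (n : nat) (g : phase R n -> phase R n -> R)
    (X : phase R n) : \bar R :=
  ereal_inf
    [set sqrte (g_sigma g X T / (g X T)%:E)%E | T in [set T | T != 0]].

Definition slow (R : realType) (n : nat) (g : phase R n -> phase R n -> R)
    : Prop :=
  exists C : R, 0 < C /\
    forall X Y, g X (X - Y) <= C^-1 ->
      forall T, T != 0 -> g X T / g Y T <= C /\ (g X T / g Y T)^-1 <= C.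

Definition uncertainty (R : realType) (n : nat)
    (g : phase R n -> phase R n -> R) : Prop :=
  forall X, (1 <= lambda_g g X)%E.

Definition temperate (R : realType) (n : nat)
    (g : phase R n -> phase R n -> R) : Prop :=
  exists (C : R) (J : nat), 0 < C /\
    forall X Y T, T != 0 ->
      ((g X T / g Y T)%:E <= C%:E * (1 + g_sigma g Y (X - Y)) ^+ J)%E /\
      (((g X T / g Y T)^-1)%:E <= C%:E * (1 + g_sigma g Y (X - Y)) ^+ J)%E.

Definition hormander_metric (R : realType) (n : nat)
    (g : phase R n -> phase R n -> R) : Prop :=
  [/\ forall X, posdef_quadratic (g X), slow g, uncertainty g & temperate g].

Definition metricAV (R : realType) (n : nat) (gamma kappa q : R)
    (A V : 'rV[R]_n -> R) (X T : phase R n) : R :=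
  enorm T.1 ^+ 2 / (q + V X.1 + A X.2) `^ (1 / kappa)
  + enorm T.2 ^+ 2 / (q + V X.1 + A X.2) `^ (1 / gamma).

(* Main.v *)
(* Write W(x, xi) = q + V x + A xi. If Gamma is a tau-function, then
   (q0 / 2 + Gamma)^(1 / (2 tau)) is bounded below by a positive constant and
   is Lipschitz up to an additive constant: outside a ball by assumption,
   inside it by compactness. Taking powers and adding the estimates for V and A,
     W(x, xi) <= D (W(y, eta) + |x - y|^(2 kappa) + |xi - eta|^(2 gamma)).
   If g_X(X - Y) is small, the last two terms are absorbed by W(X), so that W(X)
   and W(Y) are comparable; in general they are at most powers of
   g_Y^sigma(X - Y), because g_Y^sigma(t, tau)
   >= W(Y)^(1 / gamma) |t|^2 + W(Y)^(1 / kappa) |tau|^2. This gives slowness and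
   temperateness; the uncertainty principle follows from W >= 1. In dimension 0
   there is no nonzero T and the three conditions are vacuous. *)
Require Import Defs.
From HB Require Import structures.
From mathcomp Require Import all_boot all_order all_algebra.
From mathcomp Require Import all_classical all_reals all_analysis.
From mathcomp Require Import ring lra.
Import Order.TTheory GRing.Theory Num.Theory.
Import numFieldNormedType.Exports.
Local Open Scope ring_scope.

(** * Euclidean inner product and norm *)

Lemma dotvC (R : realType) (n : nat) (u v : 'rV[R]_n) : dotv u v = dotv v u.
Proof. by apply: eq_bigr => i _; rewrite mulrC. Qed.

Lemma dotvDl (R : realType) (n : nat) (u v w : 'rV[R]_n) :
  dotv (u + v) w = dotv u w + dotv v w.
Proof. by rewrite -big_split; apply: eq_bigr => i _; rewrite mxE mulrDl. Qed.

Lemma dotvZl (R : realType) (n : nat) (a : R) (u v : 'rV[R]_n) :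
  dotv (a *: u) v = a * dotv u v.
Proof. by rewrite mulr_sumr; apply: eq_bigr => i _; rewrite mxE mulrA. Qed.

Lemma dotvDr (R : realType) (n : nat) (u v w : 'rV[R]_n) :
  dotv u (v + w) = dotv u v + dotv u w.
Proof. by rewrite !(dotvC _ _ u) dotvDl. Qed.

Lemma dotvZr (R : realType) (n : nat) (a : R) (u v : 'rV[R]_n) :
  dotv u (a *: v) = a * dotv u v.
Proof. by rewrite !(dotvC _ _ u) dotvZl. Qed.

Lemma dotv_ge0 (R : realType) (n : nat) (u : 'rV[R]_n) : 0 <= dotv u u.
Proof. by apply: sumr_ge0 => i _; rewrite -expr2 sqr_ge0. Qed.

Lemma dotv_eq0 (R : realType) (n : nat) (u : 'rV[R]_n) :
  (dotv u u == 0) = (u == 0).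
Proof.
apply/eqP/eqP => [u0|->]; last first.
  by rewrite /dotv big1// => i _; rewrite mxE mul0r.
apply/rowP => i; rewrite mxE; apply/eqP; rewrite -sqrf_eq0 expr2; apply/eqP.
by move: i (erefl true); apply: psumr_eq0P u0 => i _; rewrite -expr2 sqr_ge0.
Qed.

Lemma enorm_ge0 (R : realType) (n : nat) (u : 'rV[R]_n) : 0 <= enorm u.
Proof. exact: sqrtr_ge0. Qed.

Lemma enorm_sqr (R : realType) (n : nat) (u : 'rV[R]_n) :
  enorm u ^+ 2 = dotv u u.
Proof. by rewrite sqr_sqrtr ?dotv_ge0. Qed.

Lemma enormZ (R : realType) (n : nat) (a : R) (u : 'rV[R]_n) :
  enorm (a *: u) = `|a| * enorm u.
Proof.
by rewrite /enorm dotvZl dotvZr mulrA -expr2 sqrtrM ?sqr_ge0// sqrtr_sqr.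
Qed.

Lemma enormB (R : realType) (n : nat) (u v : 'rV[R]_n) :
  enorm (u - v) = enorm (v - u).
Proof. by rewrite -opprB -scaleN1r enormZ normrN1 mul1r. Qed.

(* The factor 2 avoids Cauchy-Schwarz. *)
Lemma enormD_le (R : realType) (n : nat) (u v : 'rV[R]_n) :
  enorm (u + v) <= 2 * (enorm u + enorm v).
Proof.
have u0 := enorm_ge0 _ _ u; have v0 := enorm_ge0 _ _ v.
rewrite -(ler_pXn2r (_ : (0 < 2)%N)) ?nnegrE ?enorm_ge0//; last by lra.
have uv : enorm (u + v) ^+ 2 <= 2 * (enorm u ^+ 2 + enorm v ^+ 2).
  (* Expanding [0 <= |u - v|^2] bounds the cross term; the form [-1 *: v] lets the scaling lemmas do
     the expansion. *)
  have := dotv_ge0 _ _ (u + -1 *: v).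
  rewrite !enorm_sqr !(dotvDl, dotvDr, dotvZl, dotvZr) (dotvC _ _ v u); lra.
by apply: (le_trans uv); nra.
Qed.

(** * Positive definiteness *)

Lemma metricAV_dotE (R : realType) (n : nat) (gamma kappa q : R)
    (A V : 'rV[R]_n -> R) (X T : phase R n) :
  metricAV gamma kappa q A V X T =
    dotv T.1 T.1 / (q + V X.1 + A X.2) `^ (1 / kappa)
    + dotv T.2 T.2 / (q + V X.1 + A X.2) `^ (1 / gamma).
Proof. by rewrite /metricAV !enorm_sqr. Qed.

Lemma posdef_quadratic_dotv (R : realType) (n : nat) (a b : R) :
  0 < a -> 0 < b ->
  posdef_quadratic (fun T : phase R n => a * dotv T.1 T.1 + b * dotv T.2 T.2).
Proof.
move=> a0 b0.
pose B (S T : phase R n) := a * dotv S.1 T.1 + b * dotv S.2 T.2.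
have BC S T : B S T = B T S by rewrite /B dotvC (dotvC _ _ S.2).
have Bl T : GRing.linear_for *%R (B ^~ T).
  by move=> c S S'; rewrite /B/= !dotvDl !dotvZl; ring.
have Br S : GRing.linear_for (idfun \; *%R) (B S).
  by move=> c T T'; rewrite BC Bl !(BC S).
have Bh S T : B S T = (-1) ^+ false * idfun (B T S) by rewrite mul1r.
have Bp S : S != 0 -> 0 < B S S.
  case: S => s t; rewrite xpair_eqE negb_and -(dotv_eq0 _ _ s) -(dotv_eq0 _ _ t).
  have s0 := dotv_ge0 _ _ s; have t0 := dotv_ge0 _ _ t; rewrite /B/=.
  have as0 : 0 <= a * dotv s s by rewrite mulr_ge0// ltW.
  have bt0 : 0 <= b * dotv t t by rewrite mulr_ge0// ltW.
  case/orP => h; first by apply: ltr_pwDl; rewrite ?mulr_gt0// lt_def h.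
  by apply: ltr_wpDl; rewrite ?mulr_gt0// lt_def h.
(* The sign [false] and the conjugation [idfun] make the Hermitian condition plain symmetry. *)
pose mB := isBilinear.Build R (phase R n) (phase R n) R *%R (idfun \; *%R) B
  (fun T => zmod_morphism_linear (Bl T)) (fun S => zmod_morphism_linear (Br S))
  (fun T => scalable_linear (Bl T)) (fun S => scalable_linear (Br S)).
pose mH := isHermitianSesquilinear.Build R (phase R n) false idfun B Bh.
pose mD := isDotProduct.Build R (phase R n) B Bp.
pose D : {dot (phase R n) for (idfun : R -> R)} := HB.pack B mB mH mD.
by exists D.
Qed.

(** * Growth of a single tau-function *)

Lemma le_norm_enorm (R : realType) (n : nat) (x : 'rV[R]_n) : `|x| <= enorm x.
Proof.
rewrite /Num.norm/= mx_normrE; apply: bigmax_le; first exact: enorm_ge0.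
move=> [i j] _ /=; rewrite ord1 -sqrtr_sqr; apply: ler_wsqrtr.
rewrite /dotv (bigD1 j)//= expr2 lerDl.
by apply: sumr_ge0 => k _; rewrite -expr2 sqr_ge0.
Qed.

(** The Euclidean ball lies in the closed sup-norm ball, which is compact, so the extreme value
    theorem applies there; [0 <= r] makes that ball nonempty. *)
Lemma continuous_ubound_enorm_ball (R : realType) (n : nat)
    (f : 'rV[R]_n -> R) (r : R) :
  continuous f -> 0 <= r ->
  exists M, forall x, enorm x <= r -> f x <= M.
Proof.
move=> cf r0; pose B := [set x : 'rV[R]_n | `|x| <= r]%classic.
have B0 : (B !=set0)%classic by exists 0; rewrite /B/= normr0.
have cB : compact B.
  apply: bounded_closed_compact.
    exists r; split; first exact: num_real.
    by move=> s rs x /= xr; rewrite (le_trans xr)// ltW.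
  apply: (@closed_comp _ _ (fun x : 'rV[R]_n => `|x|) [set s | s <= r]%classic).
    by move=> x _; exact: norm_continuous.
  exact: closed_le.
have [c _ fc] := EVT_max_rV B0 cB (continuous_subspaceT cf).
exists (f c) => x xr; apply: fc; rewrite inE /B/=.
exact: le_trans (le_norm_enorm _ _ _) xr.
Qed.

(** Since [a + b] is at most twice the larger term, one argument covers exponents below and above
    1. *)
Lemma powRD_le (R : realType) (a b p : R) : 0 <= a -> 0 <= b -> 0 <= p ->
  (a + b) `^ p <= 2 `^ p * (a `^ p + b `^ p).
Proof.
move=> a0 b0 p0; wlog ab : a b a0 b0 / a <= b.
  move=> h; case: (leP a b) => [|/ltW] ab; first exact: h.
  by rewrite addrC [X in _ * X]addrC; exact: h.
apply: (@le_trans _ _ ((2 * b) `^ p)).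
  by apply: ge0_ler_powR; rewrite ?nnegrE//; lra.
by rewrite powRM// ler_wpM2l ?powR_ge0// lerDr powR_ge0.
Qed.

(** Gives a reference point on the sphere of radius [r], where the bound inside the ball meets the
    Lipschitz bound outside. Such a point requires positive dimension, hence [n.+1] here and
    below. *)
Lemma exists_enorm (R : realType) (n : nat) (r : R) : 0 <= r ->
  exists z : 'rV[R]_n.+1, enorm z = r.
Proof.
move=> r0; exists (r *: 'e_ord0); rewrite enormZ ger0_norm//.
rewrite /enorm /dotv (bigD1 ord0)//= big1 => [|i i0]; last first.
  by rewrite mxE eqxx (negPf i0) mul0r.
by rewrite mxE !eqxx mulr1 addr0 sqrtr1 mulr1.
Qed.

Lemma tau_function_growth (R : realType) (n : nat) (tau : R)
    (Gamma : 'rV[R]_n.+1 -> R) :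
  0 < tau -> tau_function tau Gamma ->
  exists q0 D : R, [/\ 0 < q0, 0 < D,
    forall x, q0 / 4 < q0 / 2 + Gamma x &
    forall x y, q0 / 2 + Gamma x <=
      D * (q0 / 2 + Gamma y + enorm (x - y) `^ (2 * tau))].
Proof.
move=> t0 [cG [q0 [q00 Gpos [C1 [r [C10 r0 Glip]]]]]].
pose f x := q0 / 2 + Gamma x; pose v x := f x `^ (1 / (2 * tau)).
have fq x : q0 / 4 < f x by have := Gpos x; rewrite /f; lra.
have f0 x : 0 <= f x by have := fq x; lra.
have fv x : f x = v x `^ (2 * tau).
  by rewrite /v -powRrM mul1r mulVf ?powRr1// mulf_neq0// gt_eqF.
have v0 x : 0 <= v x by exact: powR_ge0.
pose m := (q0 / 4) `^ (1 / (2 * tau)).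
have m0 : 0 < m by apply: powR_gt0; lra.
have p0 : 0 <= 1 / (2 * tau) by rewrite divr_ge0// mulr_ge0// ltW.
have mv x : m <= v x.
  by apply: ge0_ler_powR; rewrite ?nnegrE//; [lra|exact/ltW].
have [M0 M0P] : exists M, forall x, enorm x <= r -> v x <= M.
  have [M MP] := continuous_ubound_enorm_ball _ _ _ _ cG (ltW r0).
  exists ((q0 / 2 + M) `^ (1 / (2 * tau))) => x xr.
  have := MP x xr; have := f0 x; rewrite /v /f => fx GM.
  by apply: ge0_ler_powR; rewrite ?nnegrE//; lra.
have [z zr] := exists_enorm R n _ (ltW r0).
(* [L] is the Lipschitz constant [C1^-1] times the factor 2 lost in [enormD_le]. *)
pose L := 2 / C1; have L0 : 0 < L by exact: divr_gt0.
have Lr : 0 <= L * (4 * r) by rewrite (mulr_ge0 (ltW L0))// mulr_ge0// ltW.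
have vlip x y : r <= enorm x -> r <= enorm y ->
    v x <= v y + C1^-1 * enorm (x - y).
  move=> xr yr; rewrite -lerBlDl ler_pdivlMl//; apply: le_trans (Glip x y xr yr).
  by rewrite ler_pM2l// ler_norm.
pose M := `|M0| + v z + L * (4 * r).
have Mm : 0 <= M by rewrite addr_ge0// addr_ge0.
have vM x y : v x <= v y + M + L * enorm (x - y).
  have e0 := enorm_ge0 _ _ (x - y).
  have Le : 0 <= L * enorm (x - y) by rewrite (mulr_ge0 (ltW L0)).
  have M0n := ler_norm M0; have vy := v0 y; have vz := v0 z.
  (* If [x] is in the ball, [M0] suffices. If only [y] is, the Lipschitz bound is applied between
     [x] and [z], with [|y - z| <= 4 r]. If neither is, it applies directly. *)
  case: (leP (enorm x) r) => [/M0P xM|/ltW xr]; first by rewrite /M; lra.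
  case: (leP (enorm y) r) => [yr|/ltW yr].
    have := vlip x z xr; rewrite zr lexx => /(_ erefl) vxz.
    have xz := enormD_le _ _ (x - y) (y + -1 *: z).
    have yz := enormD_le _ _ y (-1 *: z).
    rewrite enormZ normrN1 mul1r zr in yz.
    rewrite scaleN1r addrA subrK in xz.
    rewrite scaleN1r in yz.
    have : C1^-1 * enorm (x - z) <= L * enorm (x - y) + L * (4 * r).
      have -> : L * enorm (x - y) + L * (4 * r)
          = C1^-1 * (2 * (enorm (x - y) + 4 * r)) by rewrite /L; ring.
      by rewrite ler_pM2l ?invr_gt0//; lra.
    by have := normr_ge0 M0; rewrite /M; lra.
  apply: (le_trans (vlip _ _ xr yr)).
  have : C1^-1 * enorm (x - y) <= L * enorm (x - y).
    by rewrite ler_wpM2r// /L ler_peMl ?invr_ge0 ?ltW//; lra.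
  by lra.
(* As [v y >= m], the additive constant satisfies [M <= (M / m) * v y] and becomes part of a
   factor. *)
pose c := 1 + M / m; have c0 : 0 < c by rewrite ltr_pwDl// divr_ge0// ltW.
have vc x y : v x <= c * v y + L * enorm (x - y).
  apply: (le_trans (vM x y)); rewrite lerD2r /c mulrDl mul1r lerD2l.
  by rewrite mulrAC ler_pdivlMr// ler_wpM2l.
pose P := 2 * tau; have P0 : 0 <= P by rewrite mulr_ge0// ltW.
exists q0, (2 `^ P * (c `^ P + L `^ P)); split=> //.
  by rewrite mulr_gt0 ?addr_gt0 ?powR_gt0.
move=> x y; rewrite -!/(f _) !fv -/P.
have e0 := enorm_ge0 _ _ (x - y).
have cv0 : 0 <= c * v y by rewrite (mulr_ge0 (ltW c0)).
have Le0 : 0 <= L * enorm (x - y) by rewrite (mulr_ge0 (ltW L0)).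
apply: (@le_trans _ _ ((c * v y + L * enorm (x - y)) `^ P)).
  by apply: ge0_ler_powR; rewrite ?nnegrE ?addr_ge0.
apply: (le_trans (powRD_le _ _ _ _ cv0 Le0 P0)).
rewrite -mulrA ler_wpM2l ?powR_ge0// (powRM _ (ltW c0) (v0 y)) (powRM _ (ltW L0) e0).
(* These two cross terms are what the product [(c^P + L^P) (v(y)^P + |x - y|^P)] adds to the sum
   already obtained. *)
have ce : 0 <= c `^ P * enorm (x - y) `^ P by rewrite mulr_ge0 ?powR_ge0.
have Lv : 0 <= L `^ P * v y `^ P by rewrite mulr_ge0 ?powR_ge0.
by rewrite [leRHS]mulrDl !mulrDr; apply: lerD; rewrite ?lerDl// lerDr.
Qed.

(** * Growth of the weight W *)

(** The two growth bounds add up for the shifted sum [F = W - c], where [c] may have either sign.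
    Since [F >= m > 0] and [W >= 1], the shift costs only a factor, so [F] and [W] are
    comparable. *)
Lemma weight_growth (R : realType) (n : nat) (gamma kappa q : R)
    (A V : 'rV[R]_n.+1 -> R) :
  0 < gamma -> 0 < kappa -> tau_function gamma A -> tau_function kappa V ->
  (forall x xi, 1 <= q + V x + A xi) ->
  exists2 D : R, 1 <= D & forall X Y : phase R n.+1,
    q + V X.1 + A X.2 <= D * (q + V Y.1 + A Y.2
      + enorm (X.1 - Y.1) `^ (2 * kappa) + enorm (X.2 - Y.2) `^ (2 * gamma)).
Proof.
move=> g0 k0 hA hV W1.
have [a [Da [a0 Da0 fa growa]]] := tau_function_growth _ _ _ _ g0 hA.
have [b [Db [b0 Db0 fb growb]]] := tau_function_growth _ _ _ _ k0 hV.
pose c := q - a / 2 - b / 2; pose m := (a + b) / 4.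
have m0 : 0 < m by rewrite divr_gt0// addr_gt0.
pose F x xi := b / 2 + V x + (a / 2 + A xi).
have Fm x xi : m <= F x xi by rewrite /F /m; have := fa xi; have := fb x; lra.
have WF x xi : q + V x + A xi = F x xi + c by rewrite /F /c; lra.
pose k := `|c| / m; have k00 : 0 <= k by rewrite divr_ge0// ltW.
(* One constant for both directions: [k] absorbs [|c|] into [F], and [|c|] itself absorbs it into
   [W]. *)
pose K := 1 + `|c| + k; have c0 := normr_ge0 c.
have K1 : 1 <= K by rewrite /K; lra.
have c1 := ler_norm c; have c2 := ler_norm (- c); rewrite normrN in c2.
have WKF x xi : q + V x + A xi <= K * F x xi.
  have : `|c| <= k * F x xi.
    by rewrite /k mulrAC ler_pdivlMr// ler_wpM2l.
  have : 0 <= `|c| * F x xi by rewrite mulr_ge0// (le_trans (ltW m0)).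
  by rewrite WF /K !mulrDl mul1r; lra.
have FKW x xi : F x xi <= K * (q + V x + A xi).
  have W := W1 x xi; rewrite /K !mulrDl mul1r.
  have : `|c| <= `|c| * (q + V x + A xi) by rewrite ler_peMr.
  have : 0 <= k * (q + V x + A xi) by rewrite mulr_ge0//; lra.
  by have := WF x xi; lra.
have K0 : 0 <= K by lra.
(* One [K] passes from [W(X)] to [F(X)], the other from [F(Y)] back to [W(Y)]; adding 1 below
   ensures that the final constant is at least 1. *)
pose D := K * (K * (Da + Db)).
have D0 : 0 <= D by rewrite /D !mulr_ge0//; lra.
exists (1 + D); first by lra.
move=> [x xi] [y eta] /=.
set d := enorm (x - y) `^ _; set e := enorm (xi - eta) `^ _.
have d0 : 0 <= d by exact: powR_ge0.
have e0 : 0 <= e by exact: powR_ge0.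
apply: (@le_trans _ _ (D * (q + V y + A eta + d + e))); last first.
  by rewrite [leRHS]mulrDl lerDr mul1r; have := W1 y eta; lra.
apply: (le_trans (WKF x xi)); rewrite /D -!mulrA ler_wpM2l//.
apply: (@le_trans _ _ ((Da + Db) * (F y eta + d + e))).
  have := growa xi eta; have := growb x y; rewrite -/d -/e.
  have va := fa eta; have vb := fb y.
  rewrite /F; set u := b / 2 + V y; set w := a / 2 + A eta => hx hxi.
  have h1 : 0 <= Da * (u + d) by rewrite mulr_ge0//; rewrite /u; lra.
  have h2 : 0 <= Db * (w + e) by rewrite mulr_ge0//; rewrite /w; lra.
  have -> : (Da + Db) * (u + w + d + e) =
    Db * (u + d) + Da * (w + e) + Da * (u + d) + Db * (w + e) by ring.
  by lra.
rewrite mulrCA ler_wpM2l//; first by lra.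
have hd : d <= K * d by exact: ler_peMl d0 K1.
have he : e <= K * e by exact: ler_peMl e0 K1.
by have := FKW y eta; rewrite !(mulrDr K); lra.
Qed.

(** * Comparison of single coefficients *)

(** From [w <= r u] follows [w^s <= r^s u^s <= r^p u^s]. The larger exponent [p] gives both
    coefficients of the metric, with [s] equal to [1 / kappa] and [1 / gamma], the same factor. *)
Lemma ler_div_powR (R : realType) (d u w r s p : R) :
  0 <= d -> 1 <= u -> 1 <= w -> 1 <= r -> 0 <= s <= p -> w <= r * u ->
  d / u `^ s <= r `^ p * (d / w `^ s).
Proof.
move=> d0 u1 w1 r1 /andP[s0 sp] wru.
have u0 : 0 < u `^ s by apply: powR_gt0; lra.
have w0 : 0 < w `^ s by apply: powR_gt0; lra.
rewrite mulrCA ler_wpM2l// ler_pdivlMr// mulrC ler_pdivrMr//.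
apply: (@le_trans _ _ ((r * u) `^ s)).
  by apply: ge0_ler_powR => //; rewrite nnegrE; nra.
rewrite powRM//; [|lra|lra].
by rewrite ler_wpM2r ?(ltW u0)// ler_powR.
Qed.

(** The smallness yields [B^(1/s) e^2 <= W^(1/s)], and raising to the power [s] gives the claim.
    Keeping [C] apart from [B^(1/s)] lets one slowness constant serve both terms of the metric. *)
Lemma powR_le_of_div (R : realType) (e W B C s : R) :
  0 <= e -> 1 <= W -> 1 <= B -> 0 < s -> B `^ (1 / s) <= C ->
  e ^+ 2 / W `^ (1 / s) <= C^-1 -> B * e `^ (2 * s) <= W.
Proof.
move=> e0 W1 B1 s0 BC eWC.
have B0 : 0 < B `^ (1 / s) by apply: powR_gt0; lra.
have W0 : 0 < W `^ (1 / s) by apply: powR_gt0; lra.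
have C0 : 0 < C by lra.
have powK x : 0 <= x -> (x `^ (1 / s)) `^ s = x.
  by move=> x0; rewrite -powRrM mul1r mulVf ?gt_eqF// powRr1.
have h : B `^ (1 / s) * e ^+ 2 <= W `^ (1 / s).
  rewrite ler_pdivrMr// mulrC ler_pdivlMr// in eWC.
  by apply: le_trans eWC; rewrite mulrC ler_wpM2l// sqr_ge0.
rewrite powRrM powR_mulrn// -[B]powK; last lra.
rewrite -[leRHS]powK; last lra.
rewrite -powRM ?sqr_ge0 ?(ltW B0)//.
by apply: ge0_ler_powR; rewrite ?nnegrE ?mulr_ge0 ?sqr_ge0 ?powR_ge0 ?(ltW s0).
Qed.

(** * Bounds on the metric and its dual form *)

Lemma metricAV_gt0 (R : realType) (n : nat) (gamma kappa q : R)
    (A V : 'rV[R]_n -> R) (X T : phase R n) :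
  1 <= q + V X.1 + A X.2 -> T != 0 -> 0 < metricAV gamma kappa q A V X T.
Proof.
move=> W1; case: T => t s; rewrite xpair_eqE negb_and.
rewrite -(dotv_eq0 _ _ t) -(dotv_eq0 _ _ s) metricAV_dotE /= => ts0.
have wk : 0 < (q + V X.1 + A X.2) `^ (1 / kappa) by apply: powR_gt0; lra.
have wg : 0 < (q + V X.1 + A X.2) `^ (1 / gamma) by apply: powR_gt0; lra.
have t0 : 0 <= dotv t t / (q + V X.1 + A X.2) `^ (1 / kappa).
  by rewrite divr_ge0 ?dotv_ge0 ?ltW.
have s0 : 0 <= dotv s s / (q + V X.1 + A X.2) `^ (1 / gamma).
  by rewrite divr_ge0 ?dotv_ge0 ?ltW.
case/orP: ts0 => h; first by rewrite ltr_pwDl// divr_gt0// lt_def h dotv_ge0.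
by rewrite ltr_wpDl// divr_gt0// lt_def h dotv_ge0.
Qed.

Lemma metricAV_le (R : realType) (n : nat) (gamma kappa q r : R)
    (A V : 'rV[R]_n -> R) (X Y T : phase R n) :
  0 < gamma -> 0 < kappa ->
  1 <= q + V X.1 + A X.2 -> 1 <= q + V Y.1 + A Y.2 -> 1 <= r ->
  q + V Y.1 + A Y.2 <= r * (q + V X.1 + A X.2) ->
  metricAV gamma kappa q A V X T
    <= r `^ (1 / kappa + 1 / gamma) * metricAV gamma kappa q A V Y T.
Proof.
move=> g0 k0 WX WY r1 WYX.
have ig : 0 <= 1 / gamma by rewrite divr_ge0// ltW.
have ik : 0 <= 1 / kappa by rewrite divr_ge0// ltW.
rewrite /metricAV [leRHS]mulrDr.
by apply: lerD; apply: ler_div_powR; rewrite ?sqr_ge0//; apply/andP; split; lra.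
Qed.

(* The supremum defining g_sigma is attained at Y = (-W^(1/kappa) tau,
   W^(1/gamma) t), where W = q + V x + A xi; only this lower bound is needed. *)
Lemma g_sigma_metricAV_ge (R : realType) (n : nat) (gamma kappa q : R)
    (A V : 'rV[R]_n -> R) (X T T0 : phase R n) :
  1 <= q + V X.1 + A X.2 -> T0 != 0 ->
  (((q + V X.1 + A X.2) `^ (1 / gamma) * enorm T.1 ^+ 2
    + (q + V X.1 + A X.2) `^ (1 / kappa) * enorm T.2 ^+ 2)%:E
   <= g_sigma (metricAV gamma kappa q A V) X T)%E.
Proof.
move=> W1 T00; set wg := _ `^ (1 / gamma); set wk := _ `^ (1 / kappa).
have wk0 : 0 < wk by apply: powR_gt0; lra.
have wg0 : 0 < wg by apply: powR_gt0; lra.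
(* For [T = 0] the maximiser would be zero and hence excluded, so the supremum is tested at [T0],
   with value 0. This case occurs in temperateness, when [X = Y]. *)
have [->|T_neq0] := eqVneq T 0.
  have e0 : enorm (0 : 'rV[R]_n) ^+ 2 = 0.
    by apply/eqP; rewrite enorm_sqr dotv_eq0.
  rewrite /= e0 !mulr0 addr0; apply: ereal_sup_ubound; exists T0 => //=.
  congr (_%:E); rewrite /symp /=.
  have d0 (u : 'rV[R]_n) : dotv 0 u = 0 by rewrite -(scale0r u) dotvZl mul0r.
  by rewrite (dotvC _ _ T0.1) !d0 subr0 expr0n mul0r.
pose Y : phase R n := (- wk *: T.2, wg *: T.1).
apply: ereal_sup_ubound; exists Y => /=.
  apply: contra T_neq0; rewrite /Y !xpair_eqE !scaler_eq0 oppr_eq0.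
  by rewrite !gt_eqF//= andbC; case: T {Y}.
congr (_%:E).
have -> : symp Y T = wg * enorm T.1 ^+ 2 + wk * enorm T.2 ^+ 2.
  by rewrite /symp /Y /= dotvZl dotvZr !enorm_sqr mulNr opprK.
have -> : metricAV gamma kappa q A V X Y
    = wg * enorm T.1 ^+ 2 + wk * enorm T.2 ^+ 2.
  rewrite metricAV_dotE -/wk -/wg /Y /= !(dotvZl, dotvZr) !enorm_sqr.
  by field; rewrite !gt_eqF.
(* Numerator and denominator reduce to [N^2 / N]. It remains to see [N != 0]: otherwise both norms
   vanish, contradicting positivity of the metric at [T]. *)
rewrite expr2 mulfK//.
have := metricAV_gt0 _ _ gamma kappa q A V X T W1 T_neq0.
have h1 : 0 <= wg * enorm T.1 ^+ 2 by rewrite mulr_ge0 ?sqr_ge0 ?ltW.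
have h2 : 0 <= wk * enorm T.2 ^+ 2 by rewrite mulr_ge0 ?sqr_ge0 ?ltW.
apply: contraTneq => /eqP.
rewrite paddr_eq0// (mulf_eq0 wg) (mulf_eq0 wk) (gt_eqF wg0) (gt_eqF wk0) /=.
case/andP => /eqP e1 /eqP e2.
by rewrite /metricAV e1 e2 !mul0r addr0 ltxx.
Qed.

(** * Uncertainty principle *)

(** As all powers of [W] involved are at least 1, [|t|^2 + |tau|^2] separates [g_X(T)] from the
    lower bound for the dual form. *)
Lemma uncertainty_metricAV (R : realType) (n : nat) (gamma kappa q : R)
    (A V : 'rV[R]_n -> R) :
  0 < gamma -> 0 < kappa -> (forall x xi, 1 <= q + V x + A xi) ->
  uncertainty (metricAV gamma kappa q A V).
Proof.
move=> g0 k0 W1 X; apply: le_ereal_inf_tmp => _ [T T0 <-].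
have gT := metricAV_gt0 _ _ gamma kappa q A V X T (W1 _ _) T0.
have gs := g_sigma_metricAV_ge _ _ gamma kappa q A V X T T (W1 _ _) T0.
have ge : (metricAV gamma kappa q A V X T
    <= (q + V X.1 + A X.2) `^ (1 / gamma) * enorm T.1 ^+ 2
     + (q + V X.1 + A X.2) `^ (1 / kappa) * enorm T.2 ^+ 2)%R.
  have pow1 s : 0 < s -> 1 <= (q + V X.1 + A X.2) `^ (1 / s).
    move=> s0; rewrite -[X in X <= _](powRr0 (q + V X.1 + A X.2)).
    by rewrite ler_powR// divr_ge0// ltW.
  have pk := pow1 _ k0; have pg := pow1 _ g0; rewrite /metricAV.
  have Wd (w e : R) : 1 <= w -> e ^+ 2 / w <= e ^+ 2.
    by move=> w1; rewrite ler_pdivrMr ?ler_peMr ?sqr_ge0//; lra.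
  have Wm (w e : R) : 1 <= w -> e ^+ 2 <= w * e ^+ 2.
    by move=> w1; rewrite ler_peMl ?sqr_ge0.
  apply: lerD; first exact: le_trans (Wd _ _ pk) (Wm _ _ pg).
  exact: le_trans (Wd _ _ pg) (Wm _ _ pk).
have h : (1 <= g_sigma (metricAV gamma kappa q A V) X T
    / (metricAV gamma kappa q A V X T)%:E)%E.
  rewrite inver gt_eqF// lee_pdivlMr// mul1e.
  by apply: le_trans gs; rewrite lee_fin.
rewrite -[X in (X <= _)%E](_ : sqrte 1 = 1%E); last by rewrite /= sqrtr1.
by rewrite lee_sqrt// (le_trans _ h).
Qed.

(** * Slowness *)

Lemma slow_metricAV (R : realType) (n : nat) (gamma kappa q : R)
    (A V : 'rV[R]_n.+1 -> R) :
  0 < gamma -> 0 < kappa -> tau_function gamma A -> tau_function kappa V ->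
  (forall x xi, 1 <= q + V x + A xi) -> slow (metricAV gamma kappa q A V).
Proof.
move=> g0 k0 hA hV W1.
have [D D1 grow] := weight_growth _ _ _ _ _ _ _ g0 k0 hA hV W1.
have ig : 0 <= 1 / gamma by rewrite divr_ge0// ltW.
have ik : 0 <= 1 / kappa by rewrite divr_ge0// ltW.
have D4 : 1 <= 4 * D by lra.
have C0 : 0 < (4 * D) `^ (1 / kappa + 1 / gamma) by apply: powR_gt0; lra.
(* Each of [D d] and [D e] is at most [u / 4], so half of [u] survives on the left and
   [u <= 2 D w]. *)
have absorb (u w d e : R) : 1 <= u -> 1 <= w ->
    4 * D * d <= u -> 4 * D * e <= u -> u <= D * (w + d + e) -> u <= 4 * D * w.
  move=> u1 w1 du eu; have : 0 <= D * w by apply: mulr_ge0; lra.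
  by rewrite !(mulrDr D) => Dw; lra.
have bound (u w d e : R) : 1 <= u -> 4 * D * d <= u -> 4 * D * e <= u ->
    w <= D * (u + d + e) -> w <= 4 * D * u.
  move=> u1 du eu; have : 0 <= (D - 1) * u by apply: mulr_ge0; lra.
  by rewrite !(mulrDr D) => Du; lra.
exists ((4 * D) `^ (1 / kappa + 1 / gamma)); split=> // X Y gXY T T0.
have WX := W1 X.1 X.2; have WY := W1 Y.1 Y.2.
have xy : 4 * D * enorm (X.1 - Y.1) `^ (2 * kappa) <= q + V X.1 + A X.2.
  apply: (@powR_le_of_div _ _ _ _ ((4 * D) `^ (1 / kappa + 1 / gamma)));
    rewrite ?enorm_ge0//; first by rewrite ler_powR//; lra.
  by apply: le_trans gXY; rewrite lerDl divr_ge0 ?sqr_ge0 ?powR_ge0.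
have xe : 4 * D * enorm (X.2 - Y.2) `^ (2 * gamma) <= q + V X.1 + A X.2.
  apply: (@powR_le_of_div _ _ _ _ ((4 * D) `^ (1 / kappa + 1 / gamma)));
    rewrite ?enorm_ge0//; first by rewrite ler_powR//; lra.
  by apply: le_trans gXY; rewrite lerDr divr_ge0 ?sqr_ge0 ?powR_ge0.
have XY := absorb _ _ _ _ WX WY xy xe (grow X Y).
(* The displacements are symmetric in [X] and [Y], so the bounds by [W(X)] also serve the reverse
   comparison. *)
have := grow Y X; rewrite (enormB _ _ Y.1) (enormB _ _ Y.2) => growYX.
have YX := bound _ _ _ _ WX xy xe growYX.
have gX := metricAV_gt0 _ _ gamma kappa q A V X T WX T0.
have gY := metricAV_gt0 _ _ gamma kappa q A V Y T WY T0.
by rewrite invf_div !ler_pdivrMr//; split; apply: metricAV_le.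
Qed.

(** * Temperateness *)

Lemma lee_pXn2r (R : realType) (x y : \bar R) (k : nat) :
  (0 <= x)%E -> (x <= y)%E -> (x ^+ k <= y ^+ k)%E.
Proof.
move=> x0 xy; elim: k => [|k IHk]; first by rewrite !expe0.
by rewrite !expeS; apply: lee_pmul => //; exact: expe_ge0.
Qed.

Lemma temperate_metricAV (R : realType) (n : nat) (gamma kappa q : R)
    (A V : 'rV[R]_n.+1 -> R) :
  0 < gamma -> 0 < kappa -> tau_function gamma A -> tau_function kappa V ->
  (forall x xi, 1 <= q + V x + A xi) -> temperate (metricAV gamma kappa q A V).
Proof.
move=> g0 k0 hA hV W1.
have [D D1 grow] := weight_growth _ _ _ _ _ _ _ g0 k0 hA hV W1.
have ig : 0 <= 1 / gamma by rewrite divr_ge0// ltW.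
have ik : 0 <= 1 / kappa by rewrite divr_ge0// ltW.
pose p := 1 / kappa + 1 / gamma; pose s := kappa + gamma.
have p0 : 0 <= p by rewrite addr_ge0.
have s0 : 0 < s by rewrite addr_gt0.
have sp0 : 0 <= s * p by rewrite mulr_ge0// ltW.
(* The displacement terms cost at most [(1 + S)^s], and passing from weights to metrics raises this
   to the power [p]; [J] is a natural number above [s * p]. *)
pose J := Num.bound (s * p).
have spJ : s * p <= J%:R by rewrite ltW// archi_boundP.
have C0 : 0 < (3 * D) `^ p by apply: powR_gt0; lra.
(* The 3 counts the terms [w], [d], [e], each at most [r * w]. *)
have bound (r w u d e : R) : 1 <= r -> 1 <= w -> d <= r -> e <= r ->
    u <= D * (w + d + e) -> u <= 3 * D * r * w.
  move=> r1 w1 dr er uD; apply: (le_trans uD).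
  rewrite [3 * D]mulrC -!mulrA ler_pM2l; last lra.
  have rw : 0 <= r * (w - 1) by apply: mulr_ge0; lra.
  have wr : 0 <= (r - 1) * w by apply: mulr_ge0; lra.
  by lra.
have D0 : 0 <= 3 * D by lra.
have D31 : 1 <= 3 * D by lra.
exists ((3 * D) `^ p), J; split=> // X Y T T0.
have WX := W1 X.1 X.2; have WY := W1 Y.1 Y.2.
have gX := metricAV_gt0 _ _ gamma kappa q A V X T WX T0.
have gY := metricAV_gt0 _ _ gamma kappa q A V Y T WY T0.
have gs := g_sigma_metricAV_ge _ _ gamma kappa q A V Y (X - Y) T WY T0.
(* [S] is a finite lower bound for the dual form at [X - Y]; it dominates both squared displacements
   because its coefficients are at least 1. *)
set S := (X in (X%:E <= _)%E) in gs.
have pow1 (w c : R) : 1 <= w -> 0 <= c -> 1 <= w `^ c.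
  by move=> w1 c0; rewrite -[X in X <= _](powRr0 w) ler_powR.
have wg := pow1 _ _ WY ig; have wk := pow1 _ _ WY ik.
have x0 := sqr_ge0 (enorm (X.1 - Y.1)).
have xi0 := sqr_ge0 (enorm (X.2 - Y.2)).
have Wm (w e : R) : 1 <= w -> 0 <= e -> e <= w * e.
  by move=> w1 e0; rewrite ler_peMl.
have S1 : enorm (X.1 - Y.1) ^+ 2 <= S.
  by apply: le_trans (Wm _ _ wg x0) _; rewrite lerDl (le_trans xi0)// Wm.
have S2 : enorm (X.2 - Y.2) ^+ 2 <= S.
  by apply: le_trans (Wm _ _ wk xi0) _; rewrite lerDr (le_trans x0)// Wm.
have S0 : 0 <= S by exact: le_trans S1.
clearbody S.
pose r := (1 + S) `^ s.
have r1 : 1 <= r by apply: (pow1 _ _ _ (ltW s0)); rewrite lerDl.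
have powS (e c : R) : 0 <= e -> e ^+ 2 <= S -> 0 <= c -> c <= s ->
    e `^ (2 * c) <= r.
  move=> e0 eS c0 cs; rewrite powRrM powR_mulrn//.
  apply: (@le_trans _ _ ((1 + S) `^ c)); last by rewrite ler_powR// lerDl.
  apply: ge0_ler_powR; rewrite ?nnegrE ?sqr_ge0 ?addr_ge0//.
  by rewrite (le_trans eS)// lerDr.
have xr : enorm (X.1 - Y.1) `^ (2 * kappa) <= r.
  by apply: powS; rewrite ?enorm_ge0// ?(ltW k0)// lerDl ltW.
have xir : enorm (X.2 - Y.2) `^ (2 * gamma) <= r.
  by apply: powS; rewrite ?enorm_ge0// ?(ltW g0)// lerDr ltW.
have XY := bound _ _ _ _ _ r1 WY xr xir (grow X Y).
have := grow Y X; rewrite (enormB _ _ Y.1) (enormB _ _ Y.2) => growYX.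
have YX := bound _ _ _ _ _ r1 WX xr xir growYX.
have r31 : 1 <= 3 * D * r by exact: mulr_ege1.
have S10 : 0 <= 1 + S by exact: addr_ge0.
have rJ : (3 * D * r) `^ p <= (3 * D) `^ p * (1 + S) ^+ J.
  rewrite powRM ?powR_ge0// ler_pM2l// /r -powRrM -powR_mulrn//.
  by rewrite ler_powR// lerDl.
(* Only here does [S] give way to the dual form itself, by monotonicity in the extended reals, so no
   finiteness is required. *)
have CJ : (((3 * D) `^ p * (1 + S) ^+ J)%:E <=
    ((3 * D) `^ p)%:E * (1 + g_sigma (metricAV gamma kappa q A V) Y (X - Y))
      ^+ J)%E.
  rewrite EFinM lee_pmul2l// EFin_expe EFinD.
  by apply: lee_pXn2r; rewrite ?leeD2l// -EFinD lee_fin.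
have leXY := metricAV_le _ _ _ _ q _ A V X Y T g0 k0 WX WY r31 YX.
have leYX := metricAV_le _ _ _ _ q _ A V Y X T g0 k0 WY WX r31 XY.
split; apply: le_trans CJ; rewrite lee_fin ?invf_div ler_pdivrMr//.
  by apply: le_trans leXY _; rewrite ler_pM2r.
by apply: le_trans leYX _; rewrite ler_pM2r.
Qed.

(** * Assembly of the four conditions *)

Theorem theorem3p4 (R : realType) (n : nat) (gamma kappa : R)
    (A V : 'rV[R]_n -> R) (q : R)
    (hgamma : 0 < gamma) (hkappa : 0 < kappa)
    (hA : tau_function gamma A) (hV : tau_function kappa V)
    (hq : 0 < q) (hqVA : forall x xi : 'rV[R]_n, 1 <= q + V x + A xi) :
  hormander_metric (metricAV gamma kappa q A V).
Proof.
split.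
- move=> X; have W := hqVA X.1 X.2.
  have [||B BE] := @posdef_quadratic_dotv R n
    ((q + V X.1 + A X.2) `^ (1 / kappa))^-1
    ((q + V X.1 + A X.2) `^ (1 / gamma))^-1.
  + by rewrite invr_gt0 powR_gt0//; lra.
  + by rewrite invr_gt0 powR_gt0//; lra.
  by exists B => T; rewrite -BE metricAV_dotE mulrC [X in _ + X]mulrC.
(* The growth bounds are stated in positive dimension. In dimension 0 every [T] is zero by
   [thinmx0], so any positive constant will do. *)
- case: n A V hA hV hqVA => [|n] A V hA hV hqVA; last exact: slow_metricAV.
  exists 1; split=> // X Y _ T /eqP[].
  by case: T => t s; rewrite (thinmx0 t) (thinmx0 s).
- exact: uncertainty_metricAV.
- case: n A V hA hV hqVA => [|n] A V hA hV hqVA; last exact: temperate_metricAV.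
  exists 1, 0%N; split=> // X Y T /eqP[].
  by case: T => t s; rewrite (thinmx0 t) (thinmx0 s).
Qed.
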